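(* Let $R$ be a commutative ring. Let $n_1, \ldots, n_k \geq 1$ be pairwise different positive integers, and let $m_1, \ldots, m_k$ be positive integers. Suppose that for any $i = 1, \ldots, k$, the $R$-algebra $M_{n_i}(R)^{m_i}$ has $s_i$ generators. Then the $R$-algebra $\bigoplus_{i = 1}^k M_{n_i}(R)^{m_i}$ has $\max \{ s_1, \ldots, s_k\}$ generators.
   Context: All rings are associative with a two-sided identity. $M_n(R)$ is the $R$-algebra of $n\times n$ matrices over $R$, and $M_n(R)^k$ is the direct sum of $k$ copies of it; operations in direct sums are componentwise. A set $S$ generates an $R$-algebra $A$ if every element of $A$ is an $R$-linear combination of nonempty products of elements of $S$ (the identity element is not automatically included). An algebra ''has $s$ generators'' if it can be generated by $s$ elements. *)

(* Defs.v *)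
From HB Require Import structures.
From mathcomp Require Import all_boot all_order all_algebra.

Set Implicit Arguments.
Unset Strict Implicit.
Unset Printing Implicit Defensive.

Import GRing.Theory.
Local Open Scope ring_scope.

(* MathComp's lalgType and algType require 1 != 0, which would rule out the   *)
(* zero ring as ring of coefficients, and Hierarchy Builder does not allow a  *)
(* join of lmodType and pzRingType below them. The structure of possibly zero *)
(* R-algebra therefore carries its own scaling operation, which on matrices   *)
(* is the library's *:%R.                                                     *)
HB.mixin Record PzRing_isPzAlgebra (R : pzRingType) A of GRing.PzRing A := {
  pzscale : R -> A -> A;
  pzscalerA : forall (a b : R) (u : A),
    pzscale a (pzscale b u) = pzscale (a * b) u;
  pzscale1r : left_id 1 pzscale;
  pzscalerDr : right_distributive pzscale +%R;
  pzscalerDl : forall u : A, {morph pzscale^~ u : a b / a + b};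
  pzscalerAl : forall (a : R) (u v : A), pzscale a (u * v) = pzscale a u * v;
  pzscalerAr : forall (a : R) (u v : A), pzscale a (u * v) = u * pzscale a v;
}.

#[short(type="pzAlgType")]
HB.structure Definition PzAlgebra (R : pzRingType) :=
  { A of GRing.PzRing A & PzRing_isPzAlgebra R A }.

HB.instance Definition _ (R : comPzRingType) (n : nat) :=
  PzRing_isPzAlgebra.Build R 'M[R]_n
    (@scalerA R 'M[R]_n) (@scale1r R 'M[R]_n) (@scalerDr R 'M[R]_n)
    (@scalerDl R 'M[R]_n) (@scalemxAl R n n n) (@scalemxAr R n n n).

Section FfunAlgebra.
Variables (R : pzRingType) (I : finType) (A : pzAlgType R).
Implicit Types f g : {ffun I -> A}.

Definition ffun_pzscale (a : R) f : {ffun I -> A} := [ffun i => pzscale a (f i)].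

Fact ffun_pzscalerA (a b : R) f :
  ffun_pzscale a (ffun_pzscale b f) = ffun_pzscale (a * b) f.
Proof. by apply/ffunP=> i; rewrite !ffunE pzscalerA. Qed.
Fact ffun_pzscale1r : left_id 1 ffun_pzscale.
Proof. by move=> f; apply/ffunP=> i; rewrite !ffunE pzscale1r. Qed.
Fact ffun_pzscalerDr : right_distributive ffun_pzscale +%R.
Proof. by move=> a f g; apply/ffunP=> i; rewrite !ffunE pzscalerDr. Qed.
Fact ffun_pzscalerDl f : {morph ffun_pzscale^~ f : a b / a + b}.
Proof. by move=> a b; apply/ffunP=> i; rewrite !ffunE pzscalerDl. Qed.
Fact ffun_pzscalerAl (a : R) f g : ffun_pzscale a (f * g) = ffun_pzscale a f * g.
Proof. by apply/ffunP=> i; rewrite !ffunE pzscalerAl. Qed.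
Fact ffun_pzscalerAr (a : R) f g : ffun_pzscale a (f * g) = f * ffun_pzscale a g.
Proof. by apply/ffunP=> i; rewrite !ffunE pzscalerAr. Qed.

HB.instance Definition _ := PzRing_isPzAlgebra.Build R {ffun I -> A}
  ffun_pzscalerA ffun_pzscale1r ffun_pzscalerDr ffun_pzscalerDl
  ffun_pzscalerAl ffun_pzscalerAr.
End FfunAlgebra.

Definition dirsum (R : pzRingType) (I : finType) (A : I -> pzAlgType R) :=
  {dffun forall i, A i}.

Section DirectSum.
Variables (R : pzRingType) (I : finType) (A : I -> pzAlgType R).
Local Notation D := (dirsum A).
Implicit Types f g h : D.

Definition dirsum_zero : D := [ffun i => 0 : A i].
Definition dirsum_one : D := [ffun i => 1 : A i].
Definition dirsum_opp f : D := [ffun i => - f i : A i].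
Definition dirsum_add f g : D := [ffun i => f i + g i : A i].
Definition dirsum_mul f g : D := [ffun i => f i * g i : A i].
Definition dirsum_scale (a : R) f : D := [ffun i => pzscale a (f i)].

HB.instance Definition _ := Choice.on D.

Fact dirsum_addA : associative dirsum_add.
Proof. by move=> f g h; apply/ffunP=> i; rewrite !ffunE addrA. Qed.
Fact dirsum_addC : commutative dirsum_add.
Proof. by move=> f g; apply/ffunP=> i; rewrite !ffunE addrC. Qed.
Fact dirsum_add0 : left_id dirsum_zero dirsum_add.
Proof. by move=> f; apply/ffunP=> i; rewrite !ffunE add0r. Qed.
Fact dirsum_addN : left_inverse dirsum_zero dirsum_opp dirsum_add.
Proof. by move=> f; apply/ffunP=> i; rewrite !ffunE addNr. Qed.
HB.instance Definition _ := GRing.isZmodule.Build D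
  dirsum_addA dirsum_addC dirsum_add0 dirsum_addN.

Fact dirsum_mulA : associative dirsum_mul.
Proof. by move=> f g h; apply/ffunP=> i; rewrite !ffunE mulrA. Qed.
Fact dirsum_mul1l : left_id dirsum_one dirsum_mul.
Proof. by move=> f; apply/ffunP=> i; rewrite !ffunE mul1r. Qed.
Fact dirsum_mul1r : right_id dirsum_one dirsum_mul.
Proof. by move=> f; apply/ffunP=> i; rewrite !ffunE mulr1. Qed.
Fact dirsum_mulDl : left_distributive dirsum_mul +%R.
Proof. by move=> f g h; apply/ffunP=> i; rewrite !ffunE mulrDl. Qed.
Fact dirsum_mulDr : right_distributive dirsum_mul +%R.
Proof. by move=> f g h; apply/ffunP=> i; rewrite !ffunE mulrDr. Qed.
HB.instance Definition _ := GRing.Zmodule_isPzRing.Build D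
  dirsum_mulA dirsum_mul1l dirsum_mul1r dirsum_mulDl dirsum_mulDr.

Fact dirsum_scaleA (a b : R) f :
  dirsum_scale a (dirsum_scale b f) = dirsum_scale (a * b) f.
Proof. by apply/ffunP=> i; rewrite !ffunE pzscalerA. Qed.
Fact dirsum_scale1 : left_id 1 dirsum_scale.
Proof. by move=> f; apply/ffunP=> i; rewrite !ffunE pzscale1r. Qed.
Fact dirsum_scaleDr : right_distributive dirsum_scale +%R.
Proof. by move=> a f g; apply/ffunP=> i; rewrite !ffunE pzscalerDr. Qed.
Fact dirsum_scaleDl f : {morph dirsum_scale^~ f : a b / a + b}.
Proof. by move=> a b; apply/ffunP=> i; rewrite !ffunE pzscalerDl. Qed.
Fact dirsum_scaleAl (a : R) f g : dirsum_scale a (f * g) = dirsum_scale a f * g.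
Proof. by apply/ffunP=> i; rewrite !ffunE pzscalerAl. Qed.
Fact dirsum_scaleAr (a : R) f g : dirsum_scale a (f * g) = f * dirsum_scale a g.
Proof. by apply/ffunP=> i; rewrite !ffunE pzscalerAr. Qed.
HB.instance Definition _ := PzRing_isPzAlgebra.Build R D
  dirsum_scaleA dirsum_scale1 dirsum_scaleDr dirsum_scaleDl
  dirsum_scaleAl dirsum_scaleAr.
End DirectSum.

(* A linear combination is a list of terms c *: (x_1 * ... * x_r), encoded    *)
(* as pairs (c, [:: x_1; ...; x_r]); empty words are excluded, so 1 is not    *)
(* generated for free.                                                        *)
Definition generates (R : pzRingType) (A : pzAlgType R) (S : seq A) : Prop :=
  forall a : A, exists t : seq (R * seq A),
    (forall w, w \in t -> w.2 != [::] /\ {subset w.2 <= S}) /\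
    a = \sum_(w <- t) pzscale w.1 (\prod_(x <- w.2) x).

(* The s elements need not be distinct.                                       *)
Definition has_generators (R : pzRingType) (A : pzAlgType R) (s : nat) : Prop :=
  exists S : s.-tuple A, generates S.

(* Main.v *)
From HB Require Import structures.
Require Import Defs.
From mathcomp Require Import all_boot all_order all_algebra.
From mathcomp Require Import perm.

(** The generators are the naive ones: pad the generating tuple of each summand
    with zeros up to the length of the longest one, and combine the tuples
    componentwise. They span a subring B, without unit, of the direct sum,
    and B projects onto every summand. The content is that this forces B to
    be everything, because the summands have different matrix sizes.

    Over a field this would be Goursat's lemma for algebras with no common
    simple quotient. Over an arbitrary commutative ring a polynomial identity
    replaces simple quotients. The Capelli polynomial is
    multilinear and alternating in N of its variables, so for N = n ^ 2 it
    vanishes on matrices of every size n' < n, where N matrices always have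
    dependent coordinates ([capelli_mx_eq0]); yet on matrices of size n it
    takes every value r *: delta_mx a b ([capelli_mx_unit]). Lift to B the
    arguments that produce such a value in a chosen component: the Capelli
    polynomial of the lifts lies in B, has the prescribed component of size n,
    and is zero at every smaller size. As the values r *: delta_mx a b span
    the summand additively, every element of a summand is the component of
    some element of B that is zero at all smaller sizes
    ([lift_vanishing_below]). An arbitrary element of the direct sum is then
    cleared one summand at a time, by increasing size, by subtracting elements
    of B ([subrng_full]). *)

Set Implicit Arguments.
Unset Strict Implicit.
Unset Printing Implicit Defensive.

Import GRing.Theory.
Local Open Scope ring_scope.

(** * Capelli polynomials and matrices *)

Lemma prod_scalemx (R : comPzRingType) (n : nat) (I : Type) (r : seq I)
    (c : I -> R) (M : I -> 'M[R]_n) :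
  \prod_(k <- r) (c k *: M k) = (\prod_(k <- r) c k) *: \prod_(k <- r) M k.
Proof.
elim/big_rec3: _ => [|k M' c' M'' _ ->]; first by rewrite scale1r.
by rewrite -[LHS]scalemxAl -[X in _ *: X]scalemxAr scalerA.
Qed.

(** This is the Capelli polynomial, alternating in the x. The separators z and y
    include one before the first and one after the last alternating variable,
    so that its values can be steered to any matrix unit. *)
Definition capelli (Z : pzRingType) (N : nat) (z : Z) (x y : 'I_N -> Z) : Z :=
  z * \sum_(s : 'S_N) (-1) ^+ s * \prod_k (x (s k) * y k).

Lemma rmorph_capelli (Z Z' : pzRingType) (f : {rmorphism Z -> Z'}) N z
    (x y : 'I_N -> Z) :
  f (capelli z x y) = capelli (f z) (f \o x) (f \o y).
Proof.
rewrite rmorphM rmorph_sum; congr (_ * _); apply: eq_bigr => s _.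
rewrite rmorphM rmorph_sign rmorph_prod; congr (_ * _).
by apply: eq_bigr => k _; rewrite rmorphM.
Qed.

(** Expanding each x in matrix units writes the polynomial as a combination of
    determinants, one for each choice f of a matrix position for every factor.
    There are fewer than N positions, so f repeats one of them, and two rows of
    the determinant coincide. *)
Lemma capelli_mx_eq0 (R : comPzRingType) (n N : nat) (z : 'M[R]_n)
    (x y : 'I_N -> 'M[R]_n) :
  (n * n < N)%N -> capelli z x y = 0.
Proof.
move=> ltnN; rewrite /capelli [X in _ * X](_ : _ = 0) ?mulr0 //.
pose W (f : {ffun 'I_N -> 'I_n * 'I_n}) : 'M[R]_n :=
  \prod_k (delta_mx (f k).1 (f k).2 * y k).
pose A (f : {ffun 'I_N -> 'I_n * 'I_n}) : 'M[R]_N :=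
  \matrix_(k, l) x l (f k).1 (f k).2.
transitivity (\sum_f \det (A f) *: W f).
  under [RHS]eq_bigr do rewrite scaler_suml.
  rewrite [RHS]exchange_big; apply: eq_bigr => s _ /=.
  transitivity ((-1) ^+ s *: (\prod_k (x (s k) * y k))).
    by rewrite mulr_sign scaler_sign.
  under [RHS]eq_bigr do rewrite -scalerA.
  rewrite -scaler_sumr; congr (_ *: _).
  transitivity (\prod_k \sum_p (x (s k) p.1 p.2 *: (delta_mx p.1 p.2 * y k))).
    apply: eq_bigr => k _; rewrite {1}[x (s k)]matrix_sum_delta pair_big /=.
    by rewrite mulr_suml; apply: eq_bigr => p _; rewrite -[LHS]scalemxAl.
  rewrite bigA_distr_bigA; apply: eq_bigr => f _; rewrite prod_scalemx.
  by congr (_ *: _); apply: eq_bigr => k _; rewrite mxE.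
apply: big1 => f _; have /injectivePn[k [l neq_kl eq_fkl]]: ~~ injectiveb f.
  by apply/negP => /injectiveP/leq_card; rewrite card_prod !card_ord leqNgt ltnN.
by rewrite (determinant_alternate neq_kl) ?scale0r // => i; rewrite !mxE eq_fkl.
Qed.

Lemma mul_delta_mx_delta (R : comPzRingType) (n : nat) (a b i j : 'I_n)
    (X : 'M[R]_n) :
  delta_mx a i * (X * delta_mx j b) = X i j *: delta_mx a b.
Proof.
apply/matrixP => u v; rewrite !mxE (bigD1 i) //= big1 => [|w /negPf w_i].
  rewrite !mxE (bigD1 j) //= big1 => [|w /negPf w_j]; last first.
    by rewrite !mxE w_j mulr0.
  by rewrite !mxE !eqxx andbT !addr0 mulrCA -!natrM !mulnb.
by rewrite !mxE w_i andbF mul0r.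
Qed.

(** A product whose separators are matrix units telescopes to a single entry of
    each factor: this turns the Capelli polynomial into a determinant. The row
    indices i run over nat because the last one, [i N], belongs to the right
    end of the product and to no factor. *)
Lemma delta_mx_prod (R : comPzRingType) (n N : nat) (a : 'I_n)
    (X : 'I_N -> 'M[R]_n) (i : nat -> 'I_n) (j : 'I_N -> 'I_n) :
  delta_mx a (i 0%N) * \prod_k (X k * delta_mx (j k) (i k.+1)) =
    (\prod_k X k (i k) (j k)) *: delta_mx a (i N).
Proof.
elim: N X i j => [|N IH] X i j; first by rewrite !big_ord0 mulr1 scale1r.
rewrite !big_ord_recl mulrA mul_delta_mx_delta -[LHS]scalemxAl.
rewrite -scalerA; congr (_ *: _); exact: (IH _ (fun k => i k.+1)).
Qed.

(** Take for x all the matrix units, and for separators the units that link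
    them in the order of an enumeration p of the positions: only the identity
    permutation gives a nonzero product. *)
Lemma capelli_mx_unit (R : comPzRingType) (n : nat) (r : R) (a b : 'I_n) :
  exists z (x y : 'I_(n * n) -> 'M[R]_n), capelli z x y = r *: delta_mx a b.
Proof.
have cardN : #|{: 'I_n * 'I_n}| = (n * n)%N by rewrite card_prod card_ord.
pose p (k : 'I_(n * n)) := enum_val (cast_ord (esym cardN) k).
have p_inj : injective p by move=> k l /enum_val_inj/cast_ord_inj.
(* The sequence of rows of p, continued by the final row index b. *)
pose i k := oapp (fun l => (p l).1) b (insub k).
have iE (k : 'I_(n * n)) : i k = (p k).1 by rewrite /i valK.
have iN : i (n * n)%N = b by rewrite /i insubN ?ltnn.
exists (r *: delta_mx a (i 0%N)), (fun k => delta_mx (p k).1 (p k).2).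
exists (fun k => delta_mx (p k).2 (i k.+1)).
rewrite /capelli -[LHS]scalemxAl; congr (_ *: _).
pose A : 'M[R]_(n * n) := \matrix_(k, l) delta_mx (p l).1 (p l).2 (p k).1 (p k).2.
(* A is the matrix of the entries of the x at the positions selected by the
   telescoping product; it is the identity matrix. *)
have <-: \det A *: delta_mx a b = delta_mx a b :> 'M[R]_n.
  rewrite [A](_ : _ = 1%:M) ?det1 ?scale1r //; apply/matrixP => k l.
  by rewrite !mxE -xpair_eqE -!surjective_pairing (inj_eq p_inj).
rewrite scaler_suml -[LHS]/(_ * _) mulr_sumr; apply: eq_bigr => s _.
rewrite mulr_sign -scalerA scaler_sign.
have <-: delta_mx a (i 0%N) * \prod_k (delta_mx (p (s k)).1 (p (s k)).2 *
    delta_mx (p k).2 (i k.+1)) = (\prod_k A k (s k)) *: delta_mx a b.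
  rewrite (delta_mx_prod _ (fun k => delta_mx _ _)) iN; congr (_ *: _).
  by apply: eq_bigr => k _; rewrite iE [RHS]mxE.
by case: (odd_perm s); rewrite ?mulrN.
Qed.

(** * Subrings without unit *)

(** The identity is left out on purpose: the span of nonempty products need
    not contain it a priori. *)
Definition is_subrng (Z : pzRingType) (B : Z -> Prop) : Prop :=
  [/\ B 0, forall u v, B u -> B v -> B (u - v)
         & forall u v, B u -> B v -> B (u * v)].

Section SubrngTheory.
Variables (Z : pzRingType) (B : Z -> Prop).
Hypothesis subB : is_subrng B.

Lemma subrngN u : B u -> B (- u).
Proof. by case: subB => B0 BB _ Bu; rewrite -sub0r; apply: BB. Qed.

Lemma subrngD u v : B u -> B v -> B (u + v).
Proof.
by case: subB => _ BB _ Bu /subrngN Bv; rewrite -[v]opprK; apply: BB.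
Qed.

Lemma subrng_sum (I : Type) (r : seq I) (F : I -> Z) :
  (forall i, B (F i)) -> B (\sum_(i <- r) F i).
Proof. by move=> BF; apply: big_ind => //; [case: subB | apply: subrngD]. Qed.

Lemma subrng_mul_prod (I : Type) (r : seq I) (F : I -> Z) u :
  B u -> (forall i, B (F i)) -> B (u * \prod_(i <- r) F i).
Proof.
case: subB => _ _ BM Bu BF; elim: r u Bu => [|i r IH] u Bu.
  by rewrite big_nil mulr1.
by rewrite big_cons mulrA; apply: IH; apply: BM.
Qed.

Lemma subrng_capelli N z (x y : 'I_N -> Z) :
  B z -> (forall k, B (x k)) -> (forall k, B (y k)) -> B (capelli z x y).
Proof.
case: (subB) => _ _ BM Bz Bx By; rewrite /capelli mulr_sumr.
apply: subrng_sum => s; rewrite mulr_sign.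
have BP : B (z * \prod_k (x (s k) * y k)).
  by apply: subrng_mul_prod => // k; apply: BM.
by case: (odd_perm s); rewrite ?mulrN //; apply: subrngN.
Qed.

End SubrngTheory.

(** * Projections from direct sums *)

Section Projections.
Variables (R : pzRingType) (I : finType) (A : I -> pzAlgType R) (i : I).

Definition dirsum_proj (f : dirsum A) : A i := f i.

Fact dirsum_proj_is_additive : zmod_morphism dirsum_proj.
Proof. by move=> f g; rewrite /dirsum_proj !ffunE. Qed.
HB.instance Definition _ := GRing.isZmodMorphism.Build (dirsum A) (A i)
  dirsum_proj dirsum_proj_is_additive.

Fact dirsum_proj_is_monoid_morphism : monoid_morphism dirsum_proj.
Proof. by split=> [|f g]; rewrite /dirsum_proj !ffunE. Qed.
HB.instance Definition _ := GRing.isMonoidMorphism.Build (dirsum A) (A i)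
  dirsum_proj dirsum_proj_is_monoid_morphism.

End Projections.

Section FfunProjection.
Variables (Z : pzRingType) (J : finType) (l : J).

Definition ffun_proj (f : {ffun J -> Z}) : Z := f l.

Fact ffun_proj_is_additive : zmod_morphism ffun_proj.
Proof. by move=> f g; rewrite /ffun_proj !ffunE. Qed.
HB.instance Definition _ := GRing.isZmodMorphism.Build {ffun J -> Z} Z
  ffun_proj ffun_proj_is_additive.

Fact ffun_proj_is_monoid_morphism : monoid_morphism ffun_proj.
Proof. by split=> [|f g]; rewrite /ffun_proj !ffunE. Qed.
HB.instance Definition _ := GRing.isMonoidMorphism.Build {ffun J -> Z} Z
  ffun_proj ffun_proj_is_monoid_morphism.

End FfunProjection.

Definition ffun_single (Z : pzRingType) (J : finType) (l : J) (z : Z) :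
    {ffun J -> Z} :=
  [ffun l' => if l' == l then z else 0].

(** Each tuple of matrices is the sum of its entries, which leaves only
    multiples of matrix units in a single component to be treated. *)
Lemma ffun_mx_ind (R : pzRingType) (J : finType) (n : nat)
    (Q : {ffun J -> 'M[R]_n} -> Prop) :
  Q 0 -> (forall u w, Q u -> Q w -> Q (u + w)) ->
  (forall l r a b, Q (ffun_single l (r *: delta_mx a b : 'M[R]_n))) -> forall v, Q v.
Proof.
move=> Q0 QD Q1 v.
have -> : v = \sum_l \sum_a \sum_b
      ffun_single l (v l a b *: delta_mx a b : 'M[R]_n).
  apply/ffunP => l; rewrite sum_ffunE (bigD1 l) //= [X in _ + X]big1 ?addr0 => [|l' neq].
    rewrite sum_ffunE {1}[v l]matrix_sum_delta; apply: eq_bigr => a _.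
    by rewrite sum_ffunE; apply: eq_bigr => b _; rewrite ffunE eqxx.
  rewrite sum_ffunE big1 // => a _; rewrite sum_ffunE big1 // => b _.
  by rewrite ffunE eq_sym (negPf neq).
by do 3!apply: (big_ind Q) => // ? _.
Qed.

(** * Subrings that project onto all summands *)

Section MatrixSum.
Variables (R : comPzRingType) (k : nat) (n m : 'I_k -> nat).
Local Notation A := (fun i : 'I_k => {ffun 'I_(m i) -> 'M[R]_(n i)} : pzAlgType R).
Variable B : dirsum A -> Prop.
Hypothesis subB : is_subrng B.
Hypothesis projB : forall i (v : A i), exists2 d, B d & d i = v.

(** By additivity it is enough to reach r *: delta_mx a b in one component l,
    which is the value of a Capelli polynomial in n i * n i alternating
    variables on lifts to B of elements supported at l. *)
Lemma lift_vanishing_below i (v : A i) :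
  exists2 d, B d & d i = v /\ forall j, (n j < n i)%N -> d j = 0.
Proof.
pose Q (u : A i) :=
  exists2 d, B d & d i = u /\ forall j, (n j < n i)%N -> d j = 0.
have Q0 : Q 0.
  by exists 0; [case: subB | split=> [|j _]; rewrite ffunE].
have QD u w : Q u -> Q w -> Q (u + w).
  move=> [d Bd [du d0]] [e Be [ew e0]]; exists (d + e); first exact: subrngD.
  by split=> [|j ltj]; rewrite ffunE ?du ?ew // d0 ?e0 ?addr0.
pose unit l (M : 'M[R]_(n i)) : A i := ffun_single l M.
have Qunit l r a b : Q (unit l (r *: delta_mx a b)).
  have [z [x [y <-]]] := capelli_mx_unit r a b.
  have [z' Bz' z'E] := projB (unit l z).
  have /fin_all_exists2[x' Bx' x'E] := fun t => projB (unit l (x t)).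
  have /fin_all_exists2[y' By' y'E] := fun t => projB (unit l (y t)).
  have capE j l' : capelli z' x' y' j l' = capelli (z' j l')
      (fun t => x' t j l') (fun t => y' t j l').
    rewrite -[LHS]/(ffun_proj l' (dirsum_proj j (capelli z' x' y'))).
    by rewrite !rmorph_capelli.
  exists (capelli z' x' y'); first exact: subrng_capelli.
  split=> [|j ltji].
    apply/ffunP => l'; rewrite capE z'E !ffunE.
    case: eqP => [->|/eqP neq]; last by rewrite /capelli mul0r.
    rewrite /capelli; congr (_ * _); apply: eq_bigr => s _; congr (_ * _).
    by apply: eq_bigr => t _; rewrite x'E y'E !ffunE eqxx.
  apply/ffunP => l'; rewrite capE ffunE; apply: capelli_mx_eq0.
  exact: ltn_mul.
exact: ffun_mx_ind Q0 QD Qunit v.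
Qed.

(** Elements that vanish at all sizes below a bound are shown to lie in B, by
    downward induction on the bound. Since n is injective, at most one summand
    has the size that is to be cleared; correcting it disturbs only larger
    sizes. *)
Lemma subrng_full (n_inj : injective n) (d : dirsum A) : B d.
Proof.
pose M := (\max_i n i).+1.
suff vanish K (e : dirsum A) : (forall i, (n i + K < M)%N -> e i = 0) -> B e.
  by apply: (vanish M) => i; rewrite ltnNge leq_addl.
elim: K e => [|K IH] e e0.
  rewrite [e](_ : _ = 0); first by case: subB.
  by apply/ffunP => i; rewrite e0 ?ffunE // addn0 ltnS leq_bigmax.
have [i /eqP niK | no_i] := pickP (fun i => n i + K.+1 == M)%N; last first.
  apply: IH => i lt_niK; apply: e0.
  by rewrite ltn_neqAle no_i addnS.
have [d' Bd' [d'i d'0]] := lift_vanishing_below (e i).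
rewrite -[e](subrK d'); apply: subrngD => //; apply: IH => j lt_njK.
have [-> | neq_ji] := eqVneq j i; first by rewrite !ffunE d'i subrr.
have lt_ji : (n j < n i)%N.
  rewrite ltn_neqAle (inj_eq n_inj) neq_ji /=.
  by rewrite -(leq_add2r K.+1) niK addnS.
by rewrite !ffunE d'0 // e0 ?subr0 // -niK ltn_add2r.
Qed.

End MatrixSum.

(** * The span of nonempty products *)

(** The condition that [generates] imposes on each element. *)
Definition spanned (R : pzRingType) (A : pzAlgType R) (S : seq A) (a : A) :=
  exists t : seq (R * seq A),
    (forall w, w \in t -> w.2 != [::] /\ {subset w.2 <= S}) /\
    a = \sum_(w <- t) pzscale w.1 (\prod_(x <- w.2) x).

Section Span.
Variables (R : pzRingType) (A : pzAlgType R) (S : seq A).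

Lemma pzscaler0 (c : R) : pzscale c 0 = 0 :> A.
Proof. by apply: (addrI (pzscale c 0)); rewrite -pzscalerDr !addr0. Qed.

Lemma pzscaleNr (c : R) (u : A) : pzscale (- c) u = - pzscale c u.
Proof.
have pzscale0r : pzscale (0 : R) u = 0.
  by apply: (addrI (pzscale (0 : R) u)); rewrite -pzscalerDl !addr0.
by apply: (addrI (pzscale c u)); rewrite -pzscalerDl !subrr.
Qed.

Lemma pzscaler_sum (c : R) (I : Type) (r : seq I) (F : I -> A) :
  pzscale c (\sum_(i <- r) F i) = \sum_(i <- r) pzscale c (F i).
Proof. exact: (big_morph _ (pzscalerDr c) (pzscaler0 c)). Qed.

Lemma spannedZ (c : R) u : spanned S u -> spanned S (pzscale c u).
Proof.
case=> t [tS ->]; exists [seq (c * w.1, w.2) | w <- t]; split.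
  by move=> _ /mapP[w /tS wS ->].
by rewrite big_map pzscaler_sum; apply: eq_bigr => w _; rewrite pzscalerA.
Qed.

Lemma spanned_mem u : u \in S -> spanned S u.
Proof.
move=> Su; exists [:: (1, [:: u])]; split; last by rewrite !big_seq1 pzscale1r.
by move=> w; rewrite inE => /eqP->; split=> // v; rewrite inE => /eqP->.
Qed.

Lemma spanned_subrng : is_subrng (spanned S).
Proof.
have spannedD u v : spanned S u -> spanned S v -> spanned S (u + v).
  move=> [t [tS ->]] [t' [tS' ->]]; exists (t ++ t'); rewrite big_cat.
  by split=> // w; rewrite mem_cat => /orP[/tS | /tS'].
split=> [|u v Su Sv|_ _ [t [tS ->]] [t' [tS' ->]]].
- by exists [::]; rewrite big_nil.
- by apply: spannedD => //; rewrite -[v]pzscale1r -pzscaleNr; apply: spannedZ.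
exists [seq (w.1 * w'.1, w.2 ++ w'.2) | w <- t, w' <- t']; split.
  move=> _ /allpairsP[[w w'] /= [/tS[w0 wS] /tS'[_ wS'] ->]] /=; split.
    by case: (w.2) w0.
  by move=> x; rewrite mem_cat => /orP[/wS | /wS'].
rewrite big_allpairs_dep big_distrlr; apply: eq_bigr => w _.
apply: eq_bigr => w' _ /=.
by rewrite big_cat -pzscalerA pzscalerAr pzscalerAl.
Qed.

Lemma spanned_min (P : A -> Prop) :
  is_subrng P -> (forall c u, P u -> P (pzscale c u)) ->
  (forall u, u \in S -> P u) -> forall u, spanned S u -> P u.
Proof.
move=> subP PZ PS _ [t [tS ->]]; rewrite big_seq.
have [P0 _ PM] := subP.
apply: big_ind => // [|[c w] /tS /= [w0 wS]]; first exact: (subrngD subP).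
apply: PZ; case: w w0 wS => // x w _; elim: w x => [|y w IH] x wS.
  by rewrite big_seq1; apply: PS; apply: wS; rewrite mem_head.
rewrite big_cons; apply: PM; first by apply: PS; apply: wS; rewrite mem_head.
by apply: IH => u uw; apply: wS; rewrite inE uw orbT.
Qed.

End Span.

(** Induction on spans is applied to the set of i-th components of the span of
    T, so that words in S need not be lifted letter by letter. *)
Lemma spanned_proj (R : pzRingType) (I : finType) (A : I -> pzAlgType R)
    (T : seq (dirsum A)) (i : I) (S : seq (A i)) :
  {subset S <= [seq (d : dirsum A) i | d <- T]} ->
  forall v, spanned S v -> exists2 d, spanned T d & d i = v.
Proof.
move=> ST; apply: spanned_min => [|c _ [d Td <-]|v /ST/mapP[d Td ->]].
- have [T0 TB TM] := spanned_subrng T; split.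
  + by exists 0; rewrite ?ffunE.
  + by move=> _ _ [d Td <-] [e Te <-]; exists (d - e); rewrite ?ffunE; auto.
  + by move=> _ _ [d Td <-] [e Te <-]; exists (d * e); rewrite ?ffunE; auto.
- by exists (pzscale c d); [exact: spannedZ | rewrite ffunE].
- by exists d => //; apply: spanned_mem.
Qed.

Theorem theorem2p6 (R : comPzRingType) (k : nat) (hk : (0 < k)%N)
    (n m s : 'I_k -> nat)
    (hn : forall i, (1 <= n i)%N) (n_inj : injective n)
    (hm : forall i, (1 <= m i)%N)
    (hs : forall i, @has_generators R {ffun 'I_(m i) -> 'M[R]_(n i)} (s i)) :
  has_generators
    (dirsum (fun i : 'I_k => {ffun 'I_(m i) -> 'M[R]_(n i)} : pzAlgType R))
    (\max_(i < k) s i)%N.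
Proof.
have [S genS] := fin_all_exists hs.
pose A (i : 'I_k) := {ffun 'I_(m i) -> 'M[R]_(n i)} : pzAlgType R.
(* The default value 0 of nth is the padding of the shorter tuples. *)
pose T : (\max_(i < k) s i).-tuple (dirsum A) :=
  [tuple [ffun i => nth (0 : A i) (S i) j] | j < \max_(i < k) s i].
exists T => d; apply: (subrng_full (spanned_subrng T)) => // i v.
apply: spanned_proj (genS i v) => x xS; apply/mapP.
have lt_x : (index x (S i) < \max_(i < k) s i)%N.
  by apply: leq_trans (leq_bigmax i); rewrite -{2}(size_tuple (S i)) index_mem.
exists (tnth T (Ordinal lt_x)); first exact: mem_tnth.
by rewrite tnth_mktuple ffunE nth_index.
Qed.
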